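(* Let $m(a,b)$ be a strict, isotone, symmetric mean in two variables. If $M_1$ and $M_2$ are means in three variables that are both invariant with respect to $m$, then $M_1=M_2$.
   Context: $\mathbb{R}_+^n=\{(a_1,\dots,a_n)\in\mathbb{R}^n: a_i>0\ \forall i\}$. A mean in $n$ variables is a continuous function $m$ on $\mathbb{R}_+^n$ with $\min(a_1,\dots,a_n)\le m(a_1,\dots,a_n)\le\max(a_1,\dots,a_n)$. It is symmetric if it is unchanged by every permutation of its arguments; strict if $m(a_1,\dots,a_n)$ equals $\min(a_1,\dots,a_n)$ or $\max(a_1,\dots,a_n)$ if and only if $a_1=\cdots=a_n$; isotone if it is an increasing (i.e. non-decreasing) function of each of its variables. A symmetric mean $M(a,b,c)$ is (type 1) invariant with respect to $m(a,b)$ if $M(m(a,c),m(a,b),m(b,c))=M(a,b,c)$ for all $(a,b,c)\in\mathbb{R}_+^3$. *)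

(* Defs.v *)
From HB Require Import structures.
From mathcomp Require Import all_boot all_order all_fingroup all_algebra.
From mathcomp Require Import all_classical all_reals all_analysis.

Set Implicit Arguments.
Unset Strict Implicit.
Unset Printing Implicit Defensive.

Import Order.TTheory GRing.Theory Num.Theory.
Import numFieldNormedType.Exports.

Local Open Scope classical_set_scope.
Local Open Scope ring_scope.

(* Functions of n positive variables are encoded as total functions on row
   vectors; only their values on [pos_orthant] are ever constrained. *)
Definition pos_orthant (R : realType) (n : nat) : set 'rV[R]_n :=
  [set v | forall i, 0 < v ord0 i].
Arguments pos_orthant R n : clear implicits.

Definition row2 (R : realType) (a b : R) : 'rV[R]_2 :=
  \row_(i < 2) [:: a; b]`_i.

Definition row3 (R : realType) (a b c : R) : 'rV[R]_3 :=
  \row_(i < 3) [:: a; b; c]`_i.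

(* The number of variables is n.+1, so that the minimum and the maximum of the
   entries exist; the first entry is a harmless initial value for the fold. *)
Definition vmin (R : realType) (n : nat) (v : 'rV[R]_n.+1) : R :=
  \big[Num.min/v ord0 ord0]_(i < n.+1) v ord0 i.

Definition vmax (R : realType) (n : nat) (v : 'rV[R]_n.+1) : R :=
  \big[Num.max/v ord0 ord0]_(i < n.+1) v ord0 i.

Definition is_mean (R : realType) (n : nat) (m : 'rV[R]_n.+1 -> R) : Prop :=
  {within pos_orthant R n.+1, continuous m} /\
  (forall v, pos_orthant R n.+1 v -> vmin v <= m v <= vmax v).

Definition symmetric_fun (R : realType) (n : nat) (m : 'rV[R]_n -> R) : Prop :=
  forall (s : 'S_n) (v : 'rV[R]_n),
    pos_orthant R n v -> m (col_perm s v) = m v.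

Definition strict_mean (R : realType) (n : nat) (m : 'rV[R]_n.+1 -> R) : Prop :=
  forall v, pos_orthant R n.+1 v ->
    (m v = vmin v \/ m v = vmax v) <-> (forall i j, v ord0 i = v ord0 j).

Definition isotone (R : realType) (n : nat) (m : 'rV[R]_n -> R) : Prop :=
  forall (v w : 'rV[R]_n) (i : 'I_n),
    pos_orthant R n v -> pos_orthant R n w ->
    (forall j, j != i -> v ord0 j = w ord0 j) ->
    v ord0 i <= w ord0 i -> m v <= m w.

(* Type 1 invariance; the notion only applies to symmetric means [M], so this
   requirement is part of the definition. *)
Definition invariant1 (R : realType) (m : 'rV[R]_2 -> R) (M : 'rV[R]_3 -> R)
    : Prop :=
  [/\ is_mean M, symmetric_fun M &
      forall a b c : R, 0 < a -> 0 < b -> 0 < c ->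
        M (row3 (m (row2 a c)) (m (row2 a b)) (m (row2 b c)))
        = M (row3 a b c)].

(* Main.v *)
Require Import Defs.
From mathcomp Require Import all_boot all_order all_fingroup all_algebra.
From mathcomp Require Import all_classical all_reals all_analysis.

(** By symmetry one may start from an ordered triple [a <= b <= c].  The map
    [(a, b, c) |-> (m(a,b), m(a,c), m(b,c))] keeps the triple ordered, raises
    its smallest entry, lowers its largest one, and does not change the value
    of an invariant mean.  Its iterates therefore converge to a triple
    [l <= l' <= u] with, by continuity, [m(l,l') = l] and [m(l,u) = l'];
    strictness forces [l = l'] and then [l = u].  Every invariant mean is
    squeezed between the extreme entries, so its value is [l]. *)

Import Order.TTheory GRing.Theory Num.Theory.
Import numFieldNormedType.Exports.

Local Open Scope classical_set_scope.
Local Open Scope ring_scope.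

Lemma pos_orthant_row2 (R : realType) (a b : R) :
  0 < a -> 0 < b -> pos_orthant R 2 (row2 a b).
Proof. by move=> a0 b0 [[|[|[]]] // ?]; rewrite mxE. Qed.

Lemma pos_orthant_row3 (R : realType) (a b c : R) :
  0 < a -> 0 < b -> 0 < c -> pos_orthant R 3 (row3 a b c).
Proof. by move=> a0 b0 c0 [[|[|[|[]]]] // ?]; rewrite mxE. Qed.

Lemma row3_eta (R : realType) (v : 'rV[R]_3) :
  v = row3 (v ord0 (inord 0)) (v ord0 (inord 1)) (v ord0 (inord 2)).
Proof.
apply/rowP => -[[|[|[|[]]]] // lti]; rewrite !mxE /=;
  by congr (v _ _); apply/val_inj; rewrite /= inordK.
Qed.

Lemma vmin_row2 (R : realType) (a b : R) : a <= b -> vmin (row2 a b) = a.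
Proof.
by move=> ab; rewrite /vmin !big_ord_recl big_ord0 !mxE /= (min_r ab) minxx.
Qed.

Lemma vmax_row2 (R : realType) (a b : R) : a <= b -> vmax (row2 a b) = b.
Proof.
move=> ab; rewrite /vmax !big_ord_recl big_ord0 !mxE /=.
by rewrite (max_l ab) (max_r ab).
Qed.

Lemma vmin_row3 (R : realType) (a b c : R) :
  a <= b -> b <= c -> vmin (row3 a b c) = a.
Proof.
move=> ab bc; rewrite /vmin !big_ord_recl big_ord0 !mxE /=.
by rewrite (min_r (le_trans ab bc)) (min_r ab) minxx.
Qed.

Lemma vmax_row3 (R : realType) (a b c : R) :
  a <= b -> b <= c -> vmax (row3 a b c) = c.
Proof.
move=> ab bc; rewrite /vmax !big_ord_recl big_ord0 !mxE /=.
by rewrite (max_l (le_trans ab bc)) (max_r bc) (max_r (le_trans ab bc)).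
Qed.

Section BinaryMean.
Context (R : realType) (m : 'rV[R]_2 -> R) (m_mean : is_mean m).

Lemma mean_row2_bounds (a b : R) :
  0 < a -> a <= b -> a <= m (row2 a b) <= b.
Proof.
move=> a0 ab.
have := m_mean.2 _ (pos_orthant_row2 _ _ _ a0 (lt_le_trans a0 ab)).
by rewrite vmin_row2 // vmax_row2.
Qed.

Lemma isotone_row2 (m_isotone : isotone m) (a b a' b' : R) :
  0 < a -> 0 < b -> a <= a' -> b <= b' -> m (row2 a b) <= m (row2 a' b').
Proof.
move=> a0 b0 aa' bb'.
have a'0 := lt_le_trans a0 aa'; have b'0 := lt_le_trans b0 bb'.
(* [isotone] varies one entry at a time, so the comparison passes through the intermediate point
   [(a', b)]. *)
apply: (@le_trans _ _ (m (row2 a' b))).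
  apply: (m_isotone _ _ ord0); rewrite ?mxE //; try exact: pos_orthant_row2.
  by move=> [[|[|[]]] // ?]; rewrite !mxE.
apply: (m_isotone _ _ ord_max); rewrite ?mxE //; try exact: pos_orthant_row2.
by move=> [[|[|[]]] // ?]; rewrite !mxE.
Qed.

Lemma strict_row2_eq (m_strict : strict_mean m) (a b : R) :
  0 < a -> a <= b -> m (row2 a b) = a -> a = b.
Proof.
move=> a0 ab mab.
have [+ _] := m_strict _ (pos_orthant_row2 _ _ _ a0 (lt_le_trans a0 ab)).
rewrite vmin_row2 // => /(_ (or_introl mab)) /(_ ord0 ord_max).
by rewrite !mxE.
Qed.

Lemma cvg_row2 (u v : nat -> R) (k l : R) :
  u @ \oo --> k -> v @ \oo --> l -> row2 (u n) (v n) @[n --> \oo] --> row2 k l.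
Proof.
(* Decomposing along the standard basis reduces convergence of row vectors to that of scalar
   sequences. *)
have row2E a b : row2 a b = a *: row2 1 0 + b *: row2 0 1 :> 'rV[R]_2.
  apply/rowP => -[[|[|[]]] // ?];
    by rewrite !mxE /= ?mulr1 ?mulr0 ?addr0 ?add0r.
move=> uk vl; under eq_fun do rewrite row2E.
by rewrite row2E; apply: cvgD; apply: cvgZr_tmp.
Qed.

(** Continuity of [m] is only available within the orthant, so both the limit point and all the
    terms must lie in it. *)
Lemma mean_row2_cvg (u v : nat -> R) (k l : R) :
  (forall n, 0 < u n) -> (forall n, 0 < v n) -> 0 < k -> 0 < l ->
  u @ \oo --> k -> v @ \oo --> l ->
  m (row2 (u n) (v n)) @[n --> \oo] --> m (row2 k l).
Proof.
move=> u0 v0 k0 l0 uk vl.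
have /subspace_continuousP mc := m_mean.1.
move=> P /(mc _ (pos_orthant_row2 _ _ _ k0 l0)) nearP.
apply: (@filterS _ \oo _ _ _ _ (cvg_row2 _ _ _ _ uk vl _ nearP)) => n.
by apply; exact: pos_orthant_row2.
Qed.

Definition mean_step (t : R * R * R) : R * R * R :=
  let: (a, b, c) := t in (m (row2 a b), m (row2 a c), m (row2 b c)).

Definition pos_sorted (t : R * R * R) : Prop :=
  let: (a, b, c) := t in [/\ 0 < a, a <= b & b <= c].

(** For [a <= b <= c], isotonicity gives [m(a,b) <= m(a,c) <= m(b,c)], which is why [mean_step]
    lists the means in this order. *)
Lemma pos_sorted_mean_step (m_isotone : isotone m) (t : R * R * R) :
  pos_sorted t -> pos_sorted (mean_step t).
Proof.
case: t => [[a b] c] /= [a0 ab bc].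
have b0 := lt_le_trans a0 ab; have c0 := lt_le_trans b0 bc.
split; try exact: isotone_row2.
by have /andP[/(lt_le_trans a0)] := mean_row2_bounds _ _ a0 ab.
Qed.

Lemma pos_sorted_iter (m_isotone : isotone m) (t : R * R * R) (n : nat) :
  pos_sorted t -> pos_sorted (iter n mean_step t).
Proof. by move=> t0; elim: n => //= n; exact: pos_sorted_mean_step. Qed.

Lemma iter_mean_step_cvg (m_strict : strict_mean m) (m_isotone : isotone m)
    (t : R * R * R) : pos_sorted t ->
  exists l : R, (iter n mean_step t).1.1 @[n --> \oo] --> l /\
                (iter n mean_step t).2 @[n --> \oo] --> l.
Proof.
move=> t0.
pose a n := (iter n mean_step t).1.1; pose b n := (iter n mean_step t).1.2.
pose c n := (iter n mean_step t).2.
have abc n : [/\ 0 < a n, a n <= b n & b n <= c n].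
  have := pos_sorted_iter m_isotone _ n t0.
  by rewrite /a /b /c; case: (iter n _ t) => [[? ?] ?].
have aS n : a n.+1 = m (row2 (a n) (b n)).
  by rewrite /a /b iterS; case: (iter n _ t) => [[? ?] ?].
have bS n : b n.+1 = m (row2 (a n) (c n)).
  by rewrite /a /b /c iterS; case: (iter n _ t) => [[? ?] ?].
have cS n : c n.+1 = m (row2 (b n) (c n)).
  by rewrite /b /c iterS; case: (iter n _ t) => [[? ?] ?].
have a0 n : 0 < a n by case: (abc n).
have b0 n : 0 < b n by case: (abc n) => + + _; exact: lt_le_trans.
have ac n : a n <= c n by case: (abc n) => _; exact: le_trans.
have c0 n : 0 < c n by exact: lt_le_trans (a0 n) (ac n).
have a_nd : {homo a : p q / (p <= q)%N >-> p <= q}.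
  apply/nondecreasing_seqP => n; rewrite aS.
  by case: (abc n) => ? + _ => /(mean_row2_bounds _ _ (a0 n))/andP[].
have c_ni : {homo c : p q / (p <= q)%N >-> q <= p}.
  apply/nonincreasing_seqP => n; rewrite cS.
  by case: (abc n) => _ _ /(mean_row2_bounds _ _ (b0 n))/andP[].
(* Since [a n <= c n <= c 0], the nondecreasing [a] is bounded above by [c 0]; the nonincreasing [c]
   is bounded below by 0. *)
have a_cvg : cvgn a.
  apply: nondecreasing_is_cvgn => //; exists (c 0%N) => _ [n _ <-].
  exact: le_trans (ac n) (c_ni _ _ (leq0n n)).
have c_cvg : cvgn c.
  apply: nonincreasing_is_cvgn => //; exists 0 => _ [n _ <-].
  exact: ltW.
set l := limn a in a_cvg; set u := limn c in c_cvg.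
(* The orthant is not closed: positivity of the limit comes from [a 0 <= l], and it is what allows
   continuity to be used at [(l, u)]. *)
have l0 : 0 < l.
  exact: lt_le_trans (a0 0%N) (nondecreasing_cvgn_le a_nd a_cvg 0%N).
have lu : l <= u.
  by apply: (ler_cvg_to a_cvg c_cvg); near=> n; exact: ac.
have u0 : 0 < u := lt_le_trans l0 lu.
have /andP[lm mu] := mean_row2_bounds _ _ l0 lu.
(* The middle sequence need not be monotone; its limit is read off the recursion
   [b (n+1) = m(a n, c n)]. *)
have b_cvg : b @ \oo --> m (row2 l u).
  rewrite -cvg_shiftS; under eq_fun do rewrite bS.
  exact: mean_row2_cvg.
(* Both sides are limits of [a (n+1) = m(a n, b n)]. *)
have m_fix : m (row2 l (m (row2 l u))) = l.
  have aS_cvg : m (row2 (a n) (b n)) @[n --> \oo] --> l.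
    by under eq_fun do rewrite -aS; move: a_cvg; rewrite -cvg_shiftS.
  apply: cvg_unique aS_cvg => //.
  by apply: mean_row2_cvg => //; exact: lt_le_trans lm.
(* Strictness is used first at the pair [(l, m(l,u))], then at [(l, u)]. *)
have lE := strict_row2_eq m_strict _ _ l0 lm m_fix.
have luE := strict_row2_eq m_strict _ _ l0 lu (esym lE).
by exists l; split; [exact: a_cvg | rewrite [X in _ --> X]luE; exact: c_cvg].
Unshelve. all: by end_near. Qed.

End BinaryMean.

Lemma symmetric_row3_swap12 (R : realType) (M : 'rV[R]_3 -> R) (a b c : R) :
  symmetric_fun M -> 0 < a -> 0 < b -> 0 < c ->
  M (row3 a b c) = M (row3 b a c).
Proof.
move=> M_sym a0 b0 c0.
rewrite -(M_sym (tperm (inord 0) (inord 1))); last exact: pos_orthant_row3.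
by congr M; apply/rowP => -[[|[|[|[]]]] // ?];
  rewrite !mxE permE /= -!val_eqE /= !inordK //= ?inordK.
Qed.

Lemma symmetric_row3_swap23 (R : realType) (M : 'rV[R]_3 -> R) (a b c : R) :
  symmetric_fun M -> 0 < a -> 0 < b -> 0 < c ->
  M (row3 a b c) = M (row3 a c b).
Proof.
move=> M_sym a0 b0 c0.
rewrite -(M_sym (tperm (inord 1) (inord 2))); last exact: pos_orthant_row3.
by congr M; apply/rowP => -[[|[|[|[]]]] // ?];
  rewrite !mxE permE /= -!val_eqE /= !inordK //= ?inordK.
Qed.

Section InvariantMean.
Context (R : realType) (m : 'rV[R]_2 -> R) (m_mean : is_mean m).
Context (m_isotone : isotone m).

Lemma invariant1_iter (M : 'rV[R]_3 -> R) (a b c : R) (n : nat) :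
  invariant1 m M -> pos_sorted R (a, b, c) ->
  let: (a', b', c') := iter n (mean_step R m) (a, b, c) in
  M (row3 a' b' c') = M (row3 a b c).
Proof.
move=> [_ M_sym M_inv] abc; elim: n => //= n.
have := pos_sorted_iter R m m_mean m_isotone _ n abc.
case: (iter n _ _) => [[x y] z] xyz <-.
have [x0 xy yz] := xyz; have y0 := lt_le_trans x0 xy.
have z0 := lt_le_trans y0 yz.
have [p0 pq qr] := pos_sorted_mean_step R m m_mean m_isotone _ xyz.
have q0 := lt_le_trans p0 pq; have r0 := lt_le_trans q0 qr.
(* The invariance identity puts [m(x,z)] before [m(x,y)], whereas [mean_step] keeps sorted order; a
   swap of the first two entries reconciles them. *)
by rewrite /= symmetric_row3_swap12 // M_inv.
Qed.

(** The common limit of the extreme entries is computed from [m] alone, so [l] can be chosen before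
    [M]; uniqueness follows from this order of quantifiers. *)
Lemma invariant1_value (m_strict : strict_mean m) (a b c : R) :
  pos_sorted R (a, b, c) ->
  exists l : R, forall M : 'rV[R]_3 -> R, invariant1 m M -> M (row3 a b c) = l.
Proof.
move=> abc.
have [l [al cl]] := iter_mean_step_cvg R m m_mean m_strict m_isotone _ abc.
exists l => M M_inv.
(* The value of [M] is viewed as a constant sequence, squeezed between the smallest and the largest
   entries of the iterates. *)
apply: cvg_unique (@cvg_cst _ (M (row3 a b c)) nat \oo _) _ => //.
apply: squeeze_cvgr al cl; near=> n.
have := pos_sorted_iter R m m_mean m_isotone _ n abc.
have := invariant1_iter M a b c n M_inv abc.
case: (iter n _ _) => [[x y] z] <- [x0 xy yz].
have [[_ M_bounds] _ _] := M_inv.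
have y0 := lt_le_trans x0 xy; have z0 := lt_le_trans y0 yz.
have := M_bounds _ (pos_orthant_row3 _ _ _ _ x0 y0 z0).
by rewrite vmin_row3 // vmax_row3.
Unshelve. all: by end_near. Qed.

End InvariantMean.

Theorem corollary1 (R : realType) (m : 'rV[R]_2 -> R) (M1 M2 : 'rV[R]_3 -> R)
    (m_mean : is_mean m) (m_strict : strict_mean m) (m_isotone : isotone m)
    (m_sym : symmetric_fun m)
    (M1_mean : is_mean M1) (M2_mean : is_mean M2)
    (M1_inv : invariant1 m M1) (M2_inv : invariant1 m M2) :
  forall v : 'rV[R]_3, pos_orthant R 3 v -> M1 v = M2 v.
Proof.
move=> v v0; have [_ M1_sym _] := M1_inv; have [_ M2_sym _] := M2_inv.
have sorted_eq a b c : 0 < a -> a <= b -> b <= c ->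
    M1 (row3 a b c) = M2 (row3 a b c).
  move=> a0 ab bc.
  have abc : pos_sorted R (a, b, c) by [].
  have [l Ml] := invariant1_value R m m_mean m_isotone m_strict a b c abc.
  by rewrite !Ml.
have swap12 a b c : 0 < a -> 0 < b -> 0 < c ->
    M1 (row3 b a c) = M2 (row3 b a c) -> M1 (row3 a b c) = M2 (row3 a b c).
  by move=> a0 b0 c0; rewrite !(symmetric_row3_swap12 _ _ b a).
have swap23 a b c : 0 < a -> 0 < b -> 0 < c ->
    M1 (row3 a c b) = M2 (row3 a c b) -> M1 (row3 a b c) = M2 (row3 a b c).
  by move=> a0 b0 c0; rewrite !(symmetric_row3_swap23 _ _ a c).
rewrite (row3_eta R v).
move: (v0 (inord 0)) (v0 (inord 1)) (v0 (inord 2)).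
move: (v _ (inord 0)) (v _ (inord 1)) (v _ (inord 2)) => {v v0} a b c.
(* The triple is sorted by insertion: first [a] and [b] are ordered, then [c] moves left past [b],
   and past [a] if necessary. *)
wlog ab : a b / a <= b.
  move=> H a0 b0 c0; have [/H|/ltW/H] := leP a b; first exact.
  by move=> /(_ b0 a0 c0); exact: swap12.
move=> a0 b0 c0; have [bc|/ltW cb] := leP b c; first exact: sorted_eq.
apply: swap23 => //; have [ac|/ltW ca] := leP a c; first exact: sorted_eq.
by apply: swap12 => //; exact: sorted_eq.
Qed.
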